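(* For each integer $j\ge 5$, there exists a minimal covering system whose moduli are exactly the following $j$ distinct integers (listed in increasing order): \[ 2<2^2<2^3<\dots<2^{j-4}<3\cdot 2^{j-5}<2^{j-3}<3\cdot 2^{j-4}<3\cdot 2^{j-3}. \]
   Context: A covering system is a finite set of arithmetic progressions (congruence classes $r \bmod q$) whose union is $\mathbb{Z}$. A covering system is minimal if no proper subset of its arithmetic progressions covers $\mathbb{Z}$. *)

(* Defs.v *)
From mathcomp Require Import all_boot all_order all_algebra finmap.

Set Implicit Arguments.
Unset Strict Implicit.
Unset Printing Implicit Defensive.

Local Open Scope fset_scope.

(* The pair (q, r) with r in 'I_q stands for the class of r modulo q. Since
   0 <= r < q, distinct pairs denote distinct classes and q is positive, so
   finite sets of pairs are exactly finite sets of arithmetic progressions. *)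
Definition progression := {q : nat & 'I_q}.

Definition modulus (c : progression) : nat := tag c.

Definition residue (c : progression) : nat := tagged c.

Definition in_progression (n : int) (c : progression) : Prop :=
  (n = (residue c)%:Z %[mod (modulus c)%:Z])%Z.

Definition covering (S : {fset progression}) : Prop :=
  forall n : int, exists2 c : progression, c \in S & in_progression n c.

Definition minimal_covering (S : {fset progression}) : Prop :=
  covering S /\ forall S' : {fset progression}, S' `<` S -> ~ covering S'.

(* With multiplicity: two progressions with the same modulus contribute two
   entries. *)
Definition moduli (S : {fset progression}) : seq nat :=
  [seq modulus c | c <- enum_fset S].

Definition target_moduli (j : nat) : seq nat :=
  [seq 2 ^ i | i <- iota 1 (j - 4)]
    ++ [:: 3 * 2 ^ (j - 5); 2 ^ (j - 3); 3 * 2 ^ (j - 4); 3 * 2 ^ (j - 3)].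

(* Main.v *)
(** Doubling every progression of a minimal covering system and adding
    [1 mod 2] gives a minimal covering system again, and on moduli this is
    exactly the passage from [j] to [j + 1].  Induction starts at [j = 5] from
    the classical system 0 (2), 0 (3), 1 (4), 5 (6), 7 (12).  Minimality is
    carried along as the existence, for each class, of an integer covered by
    that class only. *)
Require Import Defs.
From mathcomp Require Import all_boot all_order all_algebra finmap.
From mathcomp Require Import zify.

Set Implicit Arguments.
Unset Strict Implicit.
Unset Printing Implicit Defensive.

Import GRing.Theory.

(* For [q = 0] this is the class [0 mod 1], since [0.-1.+1 = 1]. *)
Definition prog (q r : nat) : progression :=
  Tagged (fun q => 'I_q) (@inZp q.-1 r).

Lemma modulus_prog (q r : nat) : 0 < q -> modulus (prog q r) = q.
Proof. by case: q. Qed.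

Lemma modulus_gt0 (c : progression) : 0 < modulus c.
Proof. by case: c => q [r]; apply: leq_ltn_trans. Qed.

Lemma in_progP (n : int) (q r : nat) : 0 < q ->
  in_progression n (prog q r) <-> (n = r%:Z %[mod q%:Z])%Z.
Proof.
by case: q => // q _; rewrite /in_progression /residue /modulus /= -modz_nat modz_mod.
Qed.

Definition double (c : progression) : progression :=
  prog (2 * modulus c) (2 * residue c).

Lemma modulus_double (c : progression) : modulus (double c) = 2 * modulus c.
Proof. by rewrite modulus_prog // muln_gt0 modulus_gt0. Qed.

(** The even modulus and residue force [n] to be even, and the factor 2 cancels from a congruence
    between doubles. *)
Lemma in_doubleP (n : int) (c : progression) :
  in_progression n (double c) <->
  exists2 m : int, n = (2 * m)%R & in_progression m c.
Proof.
have q_gt0 := modulus_gt0 c.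
rewrite in_progP ?muln_gt0 ?q_gt0 // !PoszM; split=> [/eqP|[m ->]].
  rewrite eqz_mod_dvd => /dvdzP[a na].
  exists ((residue c)%:Z + a * (modulus c)%:Z)%R; first lia.
  by rewrite /in_progression addrC modzMDl.
by rewrite /in_progression -!mulz_modr // => ->.
Qed.

(** Lists serve during the induction because they keep the order of the classes: the moduli then
    match [target_moduli] by plain equality. *)
Definition covering_seq (s : seq progression) : Prop :=
  forall n : int, exists2 c : progression, c \in s & in_progression n c.

Definition irredundant (s : seq progression) : Prop :=
  forall c, c \in s -> exists2 n : int, in_progression n c &
    forall c', c' \in s -> in_progression n c' -> c' = c.

Definition extend (s : seq progression) : seq progression :=
  prog 2 1 :: map double s.

Lemma covering_extend (s : seq progression) :
  covering_seq s -> covering_seq (extend s).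
Proof.
move=> cov_s n; have [n_odd|n_even] : (n = 1 %[mod 2])%Z \/ n = (2 * (n %/ 2)%Z)%R.
- by lia.
- by exists (prog 2 1); [exact: mem_head | apply/in_progP].
have [c cs nc] := cov_s (n %/ 2)%Z.
exists (double c); first by rewrite in_cons map_f ?orbT.
by apply/in_doubleP; exists (n %/ 2)%Z.
Qed.

(** The doubled classes contain only even integers, so 1 is private to the new class; a private
    integer [n] of [d] yields [2 * n], which the odd class misses. *)
Lemma irredundant_extend (s : seq progression) :
  irredundant s -> irredundant (extend s).
Proof.
move=> irr_s c; rewrite in_cons => /predU1P[->|/mapP[d ds ->]].
  exists 1%R; first exact/in_progP.
  move=> c'; rewrite in_cons => /predU1P[//|/mapP[d _ ->]] /in_doubleP[m]; lia.
have [n nd n_only] := irr_s d ds; exists (2 * n)%R; first by apply/in_doubleP; exists n.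
move=> c'; rewrite in_cons => /predU1P[->|/mapP[d' d's ->]].
  by move/in_progP => /(_ isT); lia.
case/in_doubleP=> m nm md'; have {}nm : n = m by lia.
by rewrite (n_only d') // nm.
Qed.

Definition base_system : seq progression :=
  [:: prog 2 0; prog 3 0; prog 4 1; prog 6 5; prog 12 7].

Lemma covering_base_system : covering_seq base_system.
Proof.
move=> n.
(* Modulo 12, the multiples of 2 or 3 leave 1, 5, 7, 11: the class 1 mod 4 takes 1 and 5, 5 mod 6
   takes 11, and 7 remains for the last class. *)
have [h|[h|[h|[h|h]]]] : (n = 0 %[mod 2] \/ n = 0 %[mod 3] \/ n = 1 %[mod 4] \/
  n = 5 %[mod 6] \/ n = 7 %[mod 12])%Z by lia.
- by exists (prog 2 0); [rewrite !inE eqxx | apply/in_progP].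
- by exists (prog 3 0); [rewrite !inE eqxx ?orbT | apply/in_progP].
- by exists (prog 4 1); [rewrite !inE eqxx ?orbT | apply/in_progP].
- by exists (prog 6 5); [rewrite !inE eqxx ?orbT | apply/in_progP].
- by exists (prog 12 7); [rewrite !inE eqxx ?orbT | apply/in_progP].
Qed.

Lemma irredundant_base_system : irredundant base_system.
Proof.
move=> c; rewrite !inE => /or4P[/eqP->|/eqP->|/eqP->|/orP[]/eqP->];
  (* Private integers, in the order of the classes; 5 would not do for 5 mod 6, since it is also 1
     mod 4. *)
  [exists 2%Z | exists 3%Z | exists 1%Z | exists 11%Z | exists 7%Z];
  try exact/in_progP;
  by move=> c'; rewrite !inE => /or4P[/eqP->|/eqP->|/eqP->|/orP[]/eqP->] //
    /in_progP => /(_ isT).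
Qed.

(** Doubling raises each exponent of 2 by one, and the new head restores the exponent 1. Writing the
    index as [k + 5] keeps the truncated subtractions exact. *)
Lemma target_moduliS (k : nat) :
  target_moduli (k.+1 + 5) = 2 :: map (muln 2) (target_moduli (k + 5)).
Proof.
rewrite /target_moduli.
have -> : k.+1 + 5 - 4 = (k + 5 - 4).+1 by lia.
have -> : k.+1 + 5 - 3 = (k + 5 - 3).+1 by lia.
have -> : k.+1 + 5 - 5 = (k + 5 - 5).+1 by lia.
rewrite map_cat -map_comp /= (iotaDl 1 1) -map_comp; congr (_ :: _ ++ _).
  by apply: eq_map => i /=; rewrite add1n expnS.
by rewrite !expnS !(mulnCA 2 3).
Qed.

Lemma sorted_target_moduli (k : nat) : sorted ltn (target_moduli (k + 5)).
Proof.
elim: k => // k IHk; rewrite target_moduliS.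
(* Entries above 1 have doubles above 2, so the new head 2 stays the smallest. *)
have: all (ltn 1) (target_moduli (k + 5)).
  elim: k {IHk} => // k IHk; rewrite target_moduliS /= all_map.
  by apply: sub_all IHk => i /=; lia.
case: (target_moduli (k + 5)) IHk => //= a s IHs /andP[a_gt1 _].
rewrite path_map; apply/andP; split; first lia.
by apply: sub_path IHs => x y /=; rewrite ltn_pmul2l.
Qed.

(** A proper subset omits some class, and the private integer of that class is then uncovered. *)
Lemma minimal_covering_fset (s : seq progression) :
  covering_seq s -> irredundant s -> minimal_covering [fset c in s]%fset.
Proof.
move=> cov_s irr_s; split=> [n|S' /andP[/fsubsetP sub /fsubsetPn[c]]].
  by have [c cs nc] := cov_s n; exists c; rewrite ?inE.
rewrite inE => cs cS' cov_S'; have [n _ n_only] := irr_s c cs.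
have [c' c'S' nc'] := cov_S' n; case/negP: cS'.
by rewrite -(n_only c') //; have := sub _ c'S'; rewrite inE.
Qed.

Theorem theorem2 (j : nat) (hj : 5 <= j) :
  [/\ size (target_moduli j) = j,
      sorted ltn (target_moduli j)
    & exists S : {fset progression},
        minimal_covering S /\ perm_eq (moduli S) (target_moduli j)].
Proof.
rewrite -(subnK hj); move: (j - 5) => k {j hj}.
split; first by rewrite size_cat size_map size_iota /=; lia.
  exact: sorted_target_moduli.
have [s [cov_s irr_s mod_s]] : exists s,
    [/\ covering_seq s, irredundant s & map modulus s = target_moduli (k + 5)].
  elim: k => [|k [s [cov_s irr_s mod_s]]].
    exists base_system; split=> //; first exact: covering_base_system.
    exact: irredundant_base_system.
  exists (extend s); split; [exact: covering_extend | exact: irredundant_extend |].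
  rewrite target_moduliS -mod_s /= -!map_comp.
  by congr (_ :: _); apply: eq_map => c; apply: modulus_double.
exists [fset c in s]%fset; split; first exact: minimal_covering_fset.
(* Passing to a finite set would merge repeated classes and lose moduli; strictly increasing moduli
   exclude repeats. *)
have s_uniq : uniq s.
  apply: (@map_uniq _ _ modulus); rewrite mod_s.
  exact: sorted_uniq ltn_trans ltnn _ (sorted_target_moduli k).
rewrite -mod_s; apply/perm_map/uniq_perm; rewrite ?fset_uniq //.
by move=> c; rewrite inE.
Qed.
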